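(* Let $F$ be a field. Let $k,\ell$ be integers with $k>0$ and $0\le \ell\le k$. Let $m_1,\dots,m_k$ be positive integers such that exactly $\ell$ of them are odd and $k-\ell$ of them are even, and put $N_{k,\ell}=\sum_{i=1}^k m_i-2k+\ell+2$. Then there exists a unital associative $F$-algebra $A$ such that \[ T^{(m_1)}(A)\,T^{(m_2)}(A)\cdots T^{(m_k)}(A)\not\subseteq T^{(1+N_{k,\ell})}(A). \]
   Context: For an associative algebra $A$, left-normed commutators are defined by $[a_1,a_2]=a_1a_2-a_2a_1$ and $[a_1,\dots,a_{n-1},a_n]=[[a_1,\dots,a_{n-1}],a_n]$ for $n\ge 3$. For $n\ge 2$, $T^{(n)}(A)$ denotes the two-sided ideal of $A$ generated by all commutators $[a_1,\dots,a_n]$ with $a_i\in A$, and $T^{(1)}(A)=A$. Products of ideals are the usual products of two-sided ideals. *)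

(* Defs.v *)
From HB Require Import structures.
From mathcomp Require Import all_boot all_algebra.
Set Implicit Arguments. Unset Strict Implicit. Unset Printing Implicit Defensive.
Import GRing.Theory.
Local Open Scope ring_scope.

Section Defs.
Variable R : pzRingType.

Definition comm (a b : R) : R := a * b - b * a.

Definition lcomm (s : seq R) : R := foldl comm (head 0 s) (behead s).

Definition is_ideal (I : R -> Prop) : Prop :=
  [/\ I 0,
      (forall x y, I x -> I y -> I (x - y)),
      (forall a x, I x -> I (a * x)) &
      (forall a x, I x -> I (x * a))].

Definition ideal_gen (S : R -> Prop) : R -> Prop :=
  fun x => forall J, is_ideal J -> (forall y, S y -> J y) -> J x.

(* T^(n)(R): for n >= 2 the ideal generated by all [a_1, ..., a_n];
   T^(1)(R) = R (we also put T^(0)(R) = R, never used). *)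
Definition Tn (n : nat) : R -> Prop :=
  if (n <= 1)%N then fun _ => True
  else ideal_gen (fun x => exists s : seq R, size s = n /\ x = lcomm s).

(* product of ideals I_0 I_1 ... I_{k-1}: the ideal generated by
   (equivalently, the additive span of) all products x_0 x_1 ... x_{k-1}
   with x_i in I_i *)
Definition ideal_prod (k : nat) (I : 'I_k -> R -> Prop) : R -> Prop :=
  ideal_gen (fun x => exists a : 'I_k -> R,
                (forall i, I i (a i)) /\ x = \prod_(i < k) a i).

Definition ideal_sub (P Q : R -> Prop) : Prop := forall x, P x -> Q x.
End Defs.

(* Main.v *)
Require Import Defs.
From HB Require Import structures.
From mathcomp Require Import all_boot all_algebra.
From mathcomp Require boolp.

(* Write each m_i as 2 p_i + 1 or 2 p_i + 2 and put P = \sum_i p_i, so that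
   1 + N = 2 P + 3; it suffices to treat m_i = 2 p_i + 2. The algebra is a tensor
   product A = G (x) H of two algebras with T^(3) = 0 generated by elements z_i
   with [z_i, z_j] = th_i th_j, where the th_i anticommute, have square zero and
   commute with all z_j; this replaces the Grassmann algebra (z_i = th_i up to
   scaling), which is useless in characteristic 2. H has only 2 P generators, so
   a product of P + 1 commutators of H vanishes. In
     [g h, g' h'] = [g, g'] h' h + g g' [h, h']
   the commutators of G and of H are central, and two consecutive commutations in
   A contribute at least one commutator of H, up to a shift by one at the start;
   this gives T^(2 P + 3)(A) = 0. Conversely, with generators x_i of G and y_i of
   H, the commutator [x_1 y_1, x_2, x_3 y_2, x_4 y_3, x_5 y_4, ..., x_(2 p + 2)]
   equals [x_1, x_2] [y_1, y_2] [x_3, x_4] ... [x_(2 p + 1), x_(2 p + 2)], and the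
   product of such elements over disjoint sets of generators is the product of
   all the th_i, which is nonzero. *)

Set Implicit Arguments. Unset Strict Implicit. Unset Printing Implicit Defensive.
Import GRing.Theory.
Local Open Scope ring_scope.

(** * Commutator identities *)

Section Commutators.
Variable R : pzRingType.
Implicit Types a b c d : R.

Lemma comm_eq0 a b : GRing.comm a b -> comm a b = 0.
Proof. by move=> ab; rewrite /comm ab subrr. Qed.

Lemma commE a b : comm a b = 0 -> GRing.comm a b.
Proof. exact: subr0_eq. Qed.

Lemma commMl a b c : comm (a * b) c = a * comm b c + comm a c * b.
Proof. by rewrite /comm mulrBr mulrBl !mulrA addrA subrK. Qed.

Lemma commMr a b c : comm a (b * c) = b * comm a c + comm a b * c.
Proof. by rewrite /comm mulrBr mulrBl !mulrA [RHS]addrC addrA subrK. Qed.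

Lemma comm_jacobi a b c :
  comm (comm a b) c = comm (comm a c) b + comm a (comm b c).
Proof.
have -> : comm (comm a b) c = comm (a * b) c - comm (b * a) c.
  rewrite /comm mulrBl mulrBr !opprB addrACA [RHS]addrACA.
  by congr (_ + _); rewrite addrC.
rewrite !commMl [comm (comm a c) b]/comm [comm a (comm b c)]/comm.
by rewrite [X in X - _]addrC opprD addrACA.
Qed.
End Commutators.

Lemma lcomm_rcons (R : pzRingType) (s : seq R) x :
  (0 < size s)%N -> lcomm (rcons s x) = comm (lcomm s) x.
Proof. by case: s => // y s _; rewrite /lcomm /= foldl_rcons. Qed.

(** * Linear spans *)

Section Span.
Variables (F : nzRingType) (L : lmodType F).
Implicit Types (S : L -> Prop) (a b : L).

Inductive span S : L -> Prop :=
| span_gen s : S s -> span S s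
| span0 : span S 0
| span_lin c a b : span S a -> span S b -> span S (c *: a + b).

Lemma spanD S a b : span S a -> span S b -> span S (a + b).
Proof. by move=> Sa Sb; rewrite -[a]scale1r; apply: span_lin. Qed.

Lemma spanZ S c a : span S a -> span S (c *: a).
Proof. by move=> Sa; rewrite -[_ *: _]addr0; apply: span_lin => //; apply: span0. Qed.

Lemma spanN S a : span S a -> span S (- a).
Proof. by rewrite -scaleN1r; apply: spanZ. Qed.

Lemma span_sub S1 S2 a :
  (forall s, S1 s -> span S2 s) -> span S1 a -> span S2 a.
Proof. by move=> S12; elim=> // [|c x y _ ? _ ?]; [apply: span0 | apply: span_lin]. Qed.

Lemma span_linear S1 S2 (f : L -> L) :
    linear f -> (forall s, S1 s -> span S2 (f s)) ->
  forall a, span S1 a -> span S2 (f a).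
Proof.
move=> flin fS a; elim=> // [|c x y _ ? _ ?]; last by rewrite flin; apply: span_lin.
have := flin (-1) 0 0; rewrite scaler0 addr0 scaleN1r addNr => ->.
exact: span0.
Qed.

Lemma span_bilinear S1 S2 S3 (f : L -> L -> L) :
    (forall b, linear (f^~ b)) -> (forall a, linear (f a)) ->
    (forall s t, S1 s -> S2 t -> span S3 (f s t)) ->
  forall a b, span S1 a -> span S2 b -> span S3 (f a b).
Proof.
move=> fl fr fS a b S1a S2b; apply: (span_linear (fl b) _ S1a) => s S1s.
by apply: (span_linear (fr s) _ S2b) => t; apply: fS.
Qed.
End Span.

Section SpanAlgebra.
Variables (F : nzRingType) (L : algType F).
Implicit Types (S : L -> Prop) (a b : L).

Lemma mul_linearl b : linear (fun a : L => a * b).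
Proof. by move=> c x y; rewrite mulrDl scalerAl. Qed.

Lemma mul_linearr a : linear (fun b : L => a * b).
Proof. by move=> c x y; rewrite mulrDr scalerAr. Qed.

Lemma comm_linearl b : linear (fun a : L => comm a b).
Proof.
by move=> c x y; rewrite /comm mulrDl mulrDr -scalerAl -scalerAr scalerBr opprD addrACA.
Qed.

Lemma comm_linearr a : linear (comm a : L -> L).
Proof.
by move=> c x y; rewrite /comm mulrDl mulrDr -scalerAl -scalerAr scalerBr opprD addrACA.
Qed.

Lemma spanM S1 S2 S3 :
    (forall s t, S1 s -> S2 t -> span S3 (s * t)) ->
  forall a b, span S1 a -> span S2 b -> span S3 (a * b).
Proof. exact: (span_bilinear mul_linearl mul_linearr). Qed.

Lemma span_comm S1 S2 S3 :
    (forall s t, S1 s -> S2 t -> span S3 (comm s t)) ->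
  forall a b, span S1 a -> span S2 b -> span S3 (comm a b).
Proof. exact: (span_bilinear comm_linearl comm_linearr). Qed.
End SpanAlgebra.

(** * The algebra generated by the z_i *)

(* [z i] is a generator of G when [blk i], and of H otherwise. *)
Section TwoBlocks.
Variables (F : nzRingType) (L : algType F) (z th : nat -> L) (blk : nat -> bool).
Hypothesis comm_zz : forall i j,
  comm (z i) (z j) = if blk i == blk j then th i * th j else 0.
Hypothesis comm_zth : forall i j, GRing.comm (z i) (th j).
Hypothesis thN : forall i j, th i * th j = - (th j * th i).
Hypothesis thth : forall i, th i * th i = 0.
Implicit Types (a b c d g h w : L) (s : seq nat).

Definition thprod s : L := \prod_(i <- s) th i.

Inductive word (be : bool) : L -> Prop :=
| word1 : word be 1
| wordM i w : blk i = be -> word be w -> word be (z i * w).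

(** The words in the [z i] are left unsorted, so no basis is claimed and one element may have
    several degrees: a commutator of two [z i] of a block lies in both [fil be 0] and [fil be 2]. *)
Definition mono be r a := exists w s,
  [/\ word be w, size s = r, all (fun i => blk i == be) s & a = w * thprod s].

(* [fil true 0] is G, [fil false 0] is H, and [r] is a lower bound on the degree
   in the [th i]. *)
Definition fil be r : L -> Prop := span (mono be r).

Lemma comm_zthprod i s : GRing.comm (z i) (thprod s).
Proof. by apply: GRing.commr_prod => j _; apply: comm_zth. Qed.

Lemma comm_word_th be w j : word be w -> GRing.comm w (th j).
Proof.
elim=> [|i v _ _ cv]; first exact/commr_sym/commr1.
by apply/commr_sym/commrM; apply: commr_sym.
Qed.

Lemma comm_word_thprod be w s : word be w -> GRing.comm w (thprod s).
Proof. by move=> ww; apply: commr_prod => j _; apply: comm_word_th ww. Qed.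

Lemma wordMM be v w : word be v -> word be w -> word be (v * w).
Proof.
move=> + ww; elim=> [|i u bi _ IH]; first by rewrite mul1r.
by rewrite -mulrA; apply: wordM.
Qed.

Lemma fil_word be w : word be w -> fil be 0 w.
Proof.
move=> ww; apply: span_gen; exists w, [::]; split=> //.
by rewrite /thprod big_nil mulr1.
Qed.

Lemma fil0_word be a : fil be 0 a -> span (word be) a.
Proof.
apply: span_sub => _ [w [s [ww /size0nil -> _ ->]]].
by rewrite /thprod big_nil mulr1; apply: span_gen.
Qed.

Lemma fil1 be : fil be 0 1.
Proof. exact/fil_word/word1. Qed.

Lemma fil_z i : fil (blk i) 0 (z i).
Proof. by rewrite -[z i]mulr1; apply/fil_word/wordM => //; apply: word1. Qed.

Lemma fil_th i : fil (blk i) 1 (th i).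
Proof.
apply: span_gen; exists 1, [:: i]; split=> //=; first exact: word1.
  by rewrite eqxx.
by rewrite /thprod big_seq1 mul1r.
Qed.

Lemma filM be r1 r2 a b : fil be r1 a -> fil be r2 b -> fil be (r1 + r2) (a * b).
Proof.
apply: spanM => _ _ [v [s1 [wv <- as1 ->]]] [w [s2 [ww <- as2 ->]]].
apply: span_gen; exists (v * w), (s1 ++ s2).
split; [exact: wordMM | by rewrite size_cat | by rewrite all_cat as1 |].
rewrite /thprod big_cat /= -/(thprod s1) -/(thprod s2) !mulrA.
by congr (_ * _); rewrite -!mulrA (comm_word_thprod s1 ww).
Qed.

Lemma comm_fil0_span be a b :
  (forall i, blk i = be -> GRing.comm b (z i)) -> fil be 0 a -> GRing.comm b a.
Proof.
move=> bz /fil0_word; elim=> [w ww||c x y _ bx _ b_y].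
- elim: ww => [|i v bi _ bv]; first exact: commr1.
  by apply: commrM => //; apply: bz.
- exact: commr0.
- by apply: commrD => //; rewrite /GRing.comm -scalerAr bx scalerAl.
Qed.

Lemma comm_fil_z be r a i : blk i != be -> fil be r a -> GRing.comm a (z i).
Proof.
move=> bi; elim=> [_ [w [s [ww _ _ ->]]]||c x y _ bx _ b_y]; apply: commr_sym.
- apply: commrM; last exact: comm_zthprod.
  elim: ww => [|j v bj _ bv]; first exact: commr1.
  apply: commrM => //; apply: commE; rewrite comm_zz.
  by case: eqP => // bij; rewrite bij bj eqxx in bi.
- exact: commr0.
- by apply: commrD; [rewrite /GRing.comm -scalerAr -bx scalerAl | exact: commr_sym].
Qed.

(** One side must be a polynomial in the [z i] alone, because the [th i] of G and those of H
    anticommute with each other. *)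
Lemma comm_fil be r a b : fil (~~ be) r a -> fil be 0 b -> GRing.comm a b.
Proof.
move=> fa; apply: comm_fil0_span => i bi; apply: comm_fil_z fa.
by rewrite bi; case: (be).
Qed.

(* [d] is the image of [a] under the superderivation sending [z i] to [th i]. *)
Lemma fil_derivation be a : fil be 0 a -> exists d,
  [/\ fil be 1 d,
      forall i, blk i = be -> comm a (z i) = d * th i,
      forall i, blk i = be -> GRing.comm d (z i) &
      forall i, d * th i = - (th i * d)].
Proof.
move=> /fil0_word.
elim=> [w ww||c x y _ [dx [fx xz cx ax]] _ [dy [fy yz cy ay]]].
- elim: ww => [|k v bk wv [d [fd vz cd ad]]].
    exists 0; split=> [|i _|i _|i]; first exact: span0.
    + by rewrite mul0r comm_eq0 //; apply/commr_sym/commr1.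
    + exact/commr_sym/commr0.
    + by rewrite mul0r mulr0 oppr0.
  exists (z k * d + th k * v); split=> [|i bi|i bi|i].
  + apply: spanD; first by rewrite -bk in fd *; apply: (filM (fil_z k) fd).
    by rewrite -bk in wv *; apply: (filM (fil_th k) (fil_word wv)).
  + rewrite commMl vz // comm_zz bk bi eqxx mulrDl -!mulrA.
    by rewrite (comm_word_th i wv).
  (* The commutator with [z i] is [th k * th i * d + th k * d * th i], which cancels in any
     characteristic since [d] anticommutes with [th i]. *)
  + apply: commE; rewrite /comm mulrDl mulrDr opprD addrACA.
    rewrite -![_ - _]/(comm _ _) !commMl (comm_eq0 (cd i bi)) mulr0 add0r.
    rewrite comm_zz bk bi eqxx vz // (comm_eq0 (commr_sym (comm_zth i k))).
    by rewrite mul0r addr0 ad mulrN mulrA subrr.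
  + rewrite mulrDl mulrDr opprD -!mulrA ad mulrN !mulrA; congr (- _ + _).
      by rewrite (comm_zth k i).
    by rewrite -mulrA (comm_word_th i wv) mulrA thN mulNr.
- exists 0; split=> [|i _|i _|i]; first exact: span0.
  + by rewrite mul0r comm_eq0 //; apply/commr_sym/commr0.
  + exact/commr_sym/commr0.
  + by rewrite mul0r mulr0 oppr0.
- exists (c *: dx + dy); split=> [|i bi|i bi|i].
  + exact: span_lin.
  + by rewrite comm_linearl xz // yz // mulrDl scalerAl.
  + apply/commr_sym/commrD; last exact/commr_sym/cy.
    by rewrite /GRing.comm -scalerAr -cx // scalerAl.
  + by rewrite mulrDl mulrDr -scalerAl -scalerAr ax ay scalerN opprD.
Qed.

Definition central a := forall i, GRing.comm a (z i).

Lemma central_fil be a b : central a -> fil be 0 b -> GRing.comm a b.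
Proof. by move=> ca; apply: comm_fil0_span. Qed.

Lemma fil_comm_z be a i : fil be 0 a -> blk i = be ->
  central (comm a (z i)) /\ fil be 2 (comm a (z i)).
Proof.
move=> fa bi; have [d [fd az cd _]] := fil_derivation fa; rewrite az //.
have f2 : fil be 2 (d * th i) by rewrite -bi in fd *; apply: (filM fd (fil_th i)).
split=> // j; have [bj|bj] := eqVneq (blk j) be; last exact: comm_fil_z f2.
by apply/commr_sym/commrM; [exact/commr_sym/cd | exact: comm_zth].
Qed.

(** Centrality is T^(3) = 0 for G and for H: by the Jacobi identity, commuting [comm a b] with [z i]
    only involves [comm a (z i)] and [comm b (z i)], which are central by [fil_comm_z]. *)
Lemma fil_comm be a b : fil be 0 a -> fil be 0 b ->
  central (comm a b) /\ fil be 2 (comm a b).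
Proof.
move=> fa fb; have f2 : fil be 2 (comm a b).
  elim: (fil0_word fb) => [w ww||c x y _ fx _ fy].
  - elim: ww => [|i v bi wv IH].
      by rewrite (comm_eq0 (commr1 a)); exact: span0.
    rewrite commMr; apply: spanD.
      by rewrite -bi in IH *; apply: (filM (fil_z i) IH).
    by apply: (filM (proj2 (fil_comm_z fa bi)) (fil_word wv)).
  - by rewrite (comm_eq0 (commr0 a)); exact: span0.
  - by rewrite comm_linearr; apply: span_lin.
split=> // i; have [bi|bi] := eqVneq (blk i) be; last exact: comm_fil_z f2.
apply: commE; rewrite comm_jacobi.
have /central_fil/(_ fb)/comm_eq0 -> := proj1 (fil_comm_z fa bi).
have /central_fil/(_ fa)/commr_sym/comm_eq0 -> := proj1 (fil_comm_z fb bi).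
exact: addr0.
Qed.

Lemma fil0_comm be a b : fil be 0 a -> fil be 0 b -> fil be 0 (comm a b).
Proof.
move=> fa fb; apply: spanD; first exact: (filM fa fb).
by apply: spanN; apply: (filM fb fa).
Qed.

(** * The algebra A, and the vanishing of its long commutators *)

Definition tensor : L -> Prop :=
  span (fun a => exists g h, [/\ fil true 0 g, fil false 0 h & a = g * h]).

Lemma tensorMl g h : fil true 0 g -> fil false 0 h -> tensor (g * h).
Proof. by move=> fg fh; apply: span_gen; exists g, h. Qed.

Lemma tensor_z i : tensor (z i).
Proof.
case: (blk i) (fil_z i) => fz; first by rewrite -[z i]mulr1; apply/tensorMl/fil1.
by rewrite -[z i]mul1r; apply: tensorMl => //; apply: fil1.
Qed.

Lemma tensor1 : tensor 1.
Proof. by rewrite -[1]mulr1; apply: tensorMl; apply: fil1. Qed.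

(** Since G and H commute elementwise inside [L], products multiply as in a tensor product. *)
Lemma tensorM a b : tensor a -> tensor b -> tensor (a * b).
Proof.
apply: spanM => _ _ [g [h [fg fh ->]]] [g' [h' [fg' fh' ->]]].
rewrite -mulrA (mulrA h) (@comm_fil true 0 h g' fh fg') -mulrA mulrA.
exact: tensorMl (filM fg fg') (filM fh fh').
Qed.

Lemma comm_tensor g h g' h' :
    fil true 0 g -> fil false 0 h -> fil true 0 g' -> fil false 0 h' ->
  [/\ comm g (g' * h') = comm g g' * h', comm h (g' * h') = g' * comm h h'
    & comm (g * h) (g' * h') = comm g g' * (h' * h) + g * g' * comm h h'].
Proof.
move=> fg fh fg' fh'.
have Eg : comm g (g' * h') = comm g g' * h'.
  by rewrite commMr (comm_eq0 (@comm_fil false 0 g h' fg fh')) mulr0 add0r.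
have Eh : comm h (g' * h') = g' * comm h h'.
  by rewrite commMr (comm_eq0 (@comm_fil true 0 h g' fh fg')) mul0r addr0.
by split=> //; rewrite commMl Eg Eh addrC !mulrA.
Qed.

Lemma central1 : central 1.
Proof. by move=> i; apply/commr_sym/commr1. Qed.

Lemma centralM a b : central a -> central b -> central (a * b).
Proof.
move=> ca cb i; apply/commr_sym/commrM; apply/commr_sym; first exact: ca.
exact: cb.
Qed.

Lemma central_tensor a g h :
  central a -> fil true 0 g -> fil false 0 h -> GRing.comm a (g * h).
Proof.
by move=> ca fg fh; apply: commrM; [exact: central_fil fg | exact: central_fil fh].
Qed.

(** The index [j] counts commutators of H, each of degree two in the [th i]. *)
Definition hcentral j d := central d /\ fil false j.*2 d.

Lemma hcentral_comm h h' : fil false 0 h -> fil false 0 h' -> hcentral 1 (comm h h').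
Proof. exact: fil_comm. Qed.

Lemma hcentralM i j a b : hcentral i a -> hcentral j b -> hcentral (i + j) (a * b).
Proof.
by case=> ca fa [cb fb]; split; [exact: centralM | rewrite doubleD; exact: filM].
Qed.

(** In [layerU] the G-part is central, so the next commutation acts on [h] and gains a commutator of
    H. In [layerV] the H-part is central, so it acts on [g] without gain. *)
Definition layerU j a := exists c h d,
  [/\ fil true 0 c /\ central c, fil false 0 h, hcentral j d & a = c * h * d].

Definition layerV j a := exists g d, [/\ fil true 0 g, hcentral j d & a = g * d].

(* Commutation with A maps [layerU j] to [layerV j.+1] and [layerV j] to [layerU j]. *)
Definition layer i j := span (fun a => layerU i a \/ layerV j a).

Lemma comm_tensor_layer a b : tensor a -> tensor b -> layer 0 1 (comm a b).
Proof.
apply: span_comm => _ _ [g [h [fg fh ->]]] [g' [h' [fg' fh' ->]]].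
have [_ _ ->] := comm_tensor fg fh fg' fh'; have [cgg fgg] := fil_comm fg fg'.
apply: spanD; apply: span_gen; [left | right].
  exists (comm g g'), (h' * h), 1; rewrite mulr1; split=> //.
  - by split=> //; apply: fil0_comm.
  - exact: (filM fh' fh).
  - by split; [exact: central1 | exact: fil1].
exists (g * g'), (comm h h'); split=> //; first exact: (filM fg fg').
exact: hcentral_comm.
Qed.

Lemma comm_layer i j a b : layer i j a -> tensor b -> layer j i.+1 (comm a b).
Proof.
apply: span_comm => s t Us [g' [h' [fg' fh' ->]]].
case: Us => [[c [h [d [[fc cc] fh cd ->]]]]|[g [d [fg cd ->]]]];
  apply: span_gen; [right | left].
- have [_ E _] := comm_tensor fc fh fg' fh'.
  rewrite commMl (comm_eq0 (central_tensor (proj1 cd) fg' fh')) mulr0 add0r.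
  rewrite commMl (comm_eq0 (central_tensor cc fg' fh')) mul0r addr0 E.
  exists (c * g'), (comm h h' * d); rewrite !mulrA.
  split=> //; first exact: (filM fc fg').
  exact: hcentralM (hcentral_comm fh fh') cd.
- have [E _ _] := comm_tensor fg (fil1 false) fg' fh'.
  rewrite commMl (comm_eq0 (central_tensor (proj1 cd) fg' fh')) mulr0 add0r E.
  have [cgg fgg] := fil_comm fg fg'.
  exists (comm g g'), h', d; split=> //; split=> //; exact: fil0_comm.
Qed.

(** Each commutation sends the indices (i, j) to (j, i + 1), so from (0, 1) they run through (1, 1),
    (1, 2), (2, 2) and so on. *)
Lemma foldl_comm_layer (s : seq L) r a :
    layer (uphalf r) r./2.+1 a -> (forall x, x \in s -> tensor x) ->
  layer (uphalf (r + size s)) (r + size s)./2.+1 (foldl (@comm L) a s).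
Proof.
elim: s r a => [|x s IH] r a /= la ts; first by rewrite addn0.
rewrite addnS -addSn; apply: IH => [|y ys]; last by apply: ts; rewrite inE ys orbT.
by apply: comm_layer => //; apply: ts; rewrite mem_head.
Qed.

Lemma lcomm_layer (s : seq L) r : size s = r.+2 ->
  (forall x, x \in s -> tensor x) -> layer (uphalf r) r./2.+1 (lcomm s).
Proof.
case: s => [|x [|y s]] //= [<-] ts.
rewrite /lcomm /=; apply: (@foldl_comm_layer s 0) => [|t st].
  by apply: comm_tensor_layer; apply: ts; rewrite !inE eqxx ?orbT.
by apply: ts; rewrite !inE st !orbT.
Qed.

Lemma lcomm_tensor_eq0 P (s : seq L) :
    (forall t, all (fun i => blk i == false) t -> (P.*2 < size t)%N -> thprod t = 0) ->
    size s = P.*2.+3 -> (forall x, x \in s -> tensor x) ->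
  lcomm s = 0.
Proof.
move=> th0 ss ts.
have fil_eq0 d : fil false P.+1.*2 d -> d = 0.
  elim=> [_ [w [t [_ st at_ ->]]]||c x y _ -> _ ->] //; last by rewrite scaler0 addr0.
  by rewrite th0 ?mulr0 // st doubleS.
(* Length 2P + 3 means r = 2P + 1, the first value for which both indices reach P + 1. *)
have := lcomm_layer ss ts; rewrite /= uphalf_double doubleK.
elim=> [a|//|c x y _ -> _ ->]; last by rewrite scaler0 addr0.
by case=> [[c [h [d [_ _ [_ /fil_eq0 ->] ->]]]]|[g [d [_ [_ /fil_eq0 ->] ->]]]];
  rewrite mulr0.
Qed.

(** * Commutators that factor into commutators of pairs *)

Definition pair_comm q := comm (z q.*2) (z q.*2.+1).

(* Only the last entry of [s] involves [h]; taking for [h] the next generator of H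
   makes the induction on [r] work. *)
Lemma lcomm_alternating r o h :
    (forall q, q < r.*2.+1 -> blk (o + q).*2 = ~~ odd q /\
       blk (o + q).*2.+1 = ~~ odd q)%N -> fil false 0 h ->
  exists s : seq L, [/\ size s = r.*2.+2, forall x, x \in s -> tensor x
    & lcomm s = (\prod_(o <= q < o + r.*2.+1) pair_comm q) * h].
Proof.
elim: r h => [|r IH] h blkE fh.
  have [/= b0 b1] := blkE 0 isT; rewrite addn0 in b0 b1.
  exists [:: z o.*2 * h; z o.*2.+1]; split=> //.
    move=> x; rewrite !inE => /orP[] /eqP ->; last exact: tensor_z.
    by apply: tensorMl => //; rewrite -b0; apply: fil_z.
  rewrite addn1 big_nat1 /lcomm /= commMl (@comm_eq0 _ h) ?mulr0 ?add0r //.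
  by apply: comm_fil_z fh; rewrite b1.
have blkE' q : (q < r.*2.+1)%N -> blk (o + q).*2 = ~~ odd q /\
    blk (o + q).*2.+1 = ~~ odd q.
  by move=> qr; apply: blkE; rewrite doubleS !ltnS ltnW // ltnW.
have [|/=] := blkE r.*2.+1; first by rewrite doubleS.
have [|/=] := blkE r.*2.+2; first by rewrite doubleS.
rewrite !odd_double /=; set x := (o + r.*2.+2)%N; set y := (o + r.*2.+1)%N.
move=> x0 x1 y0 y1.
have fz i be : blk i = be -> fil be 0 (z i) by move=> <-; apply: fil_z.
have [s [ss ts Es]] := IH (z y.*2) blkE' (fz _ _ y0).
(* The first new entry closes the pair [y] of H and opens the pair [x] of G, turning [C * z y.*2]
   into [C * z x.*2 * pair_comm y]. The second closes [x] and brings in [h]. *)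
exists (rcons (rcons s (z x.*2 * z y.*2.+1)) (z x.*2.+1 * h)).
split=> [|t|]; first by rewrite !size_rcons ss.
  rewrite !(inE, mem_rcons) => /or3P[/eqP ->|/eqP ->|/ts //].
    by apply: tensorMl fh; apply: fz.
  by apply: tensorMl; apply: fz.
have cpair q be : blk q.*2 = be -> blk q.*2.+1 = be -> central (pair_comm q).
  by move=> b0 b1; apply: (proj1 (fil_comm_z (fz _ _ b0) b1)).
have [cX cY] : central (pair_comm x) /\ central (pair_comm y).
  by split; [apply: cpair x0 x1 | apply: cpair y0 y1].
set C := \prod_(_ <= _ < _) _ in Es.
have cC : central C.
  move=> i; apply/commr_sym; rewrite /C big_seq.
  apply: commr_prod => q; rewrite mem_index_iota => /andP[oq qr]; apply/commr_sym.
  have [|b0 b1] := blkE' (q - o)%N; first by rewrite ltn_subLR.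
  by move: b0 b1; rewrite subnKC // => b0 b1; exact: (cpair _ _ b0 b1 i).
rewrite !lcomm_rcons ?size_rcons ?ss // Es.
have -> : \prod_(o <= q < o + r.+1.*2.+1) pair_comm q
        = C * pair_comm y * pair_comm x.
  have [-> Exy] : (o + r.+1.*2.+1 = x.+1)%N /\ x = y.+1.
    by rewrite /x /y doubleS !addnS.
  have oy : (o <= y)%N by apply: leq_addr.
  by rewrite Exy !big_nat_recr // ltnW.
have fzx := fz _ _ x0; have fzx' := fz _ _ x1.
have fzy := fz _ _ y0; have fzy' := fz _ _ y1.
rewrite commMl (comm_eq0 (central_tensor cC fzx fzy')) mul0r addr0.
have [_ -> _] := comm_tensor fzx fzy fzx fzy'.
rewrite commMl (comm_eq0 (central_tensor cC fzx' fh)) mul0r addr0.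
rewrite commMl (comm_eq0 (central_tensor cY fzx' fh)) mulr0 add0r.
have [-> _ _] := comm_tensor fzx fh fzx' fh.
rewrite -!mulrA; congr (C * _); rewrite -[comm _ _ * _]/(pair_comm x * _).
have cYxh : GRing.comm (pair_comm y) (pair_comm x * h).
  by apply: central_tensor => //; apply: fil0_comm.
by rewrite mulrA -cYxh.
Qed.

(** * Vanishing products of the [th i] *)

Lemma th_thprod i s : i \in s -> th i * thprod s = 0.
Proof.
elim: s => //= j s IH; rewrite inE /thprod big_cons -/(thprod s) mulrA.
case: eqP => [-> _|_ /= /IH is0]; first by rewrite thth mul0r.
by rewrite thN mulNr -mulrA is0 mulr0 oppr0.
Qed.

Lemma thprod_nuniq s : ~~ uniq s -> thprod s = 0.
Proof.
elim: s => //= i s IH; rewrite negb_and negbK /thprod big_cons => /orP[|/IH].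
  exact: th_thprod.
by rewrite /thprod => ->; rewrite mulr0.
Qed.

(** Pigeonhole: more than [P] indices of H include either a repetition or an index at least [n]. *)
Lemma thprod_eq0 n P : (forall i, (n <= i)%N -> th i = 0) ->
    (count (fun i => blk i == false) (iota 0 n) <= P)%N ->
  forall t, all (fun i => blk i == false) t -> (P < size t)%N -> thprod t = 0.
Proof.
move=> th0 cP t at_ Pt; have [ut|] := boolP (uniq t); last exact: thprod_nuniq.
have [/hasP[i it ni]|/hasPn tn] := boolP (has (leq n) t).
  elim: t it {at_ Pt ut} => //= j t IH; rewrite inE /thprod big_cons.
  case/orP=> [/eqP <-|/IH]; first by rewrite th0 ?mul0r.
  by rewrite /thprod => ->; rewrite mulr0.
move: Pt; rewrite ltnNge -size_filter in cP *; case/negP; apply: leq_trans cP.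
apply: uniq_leq_size => // i it; rewrite mem_filter (allP at_) // mem_iota add0n.
by rewrite leq0n /= ltnNge; apply: tn.
Qed.
End TwoBlocks.

(** * Matrix model of the relations *)

Section UpperTriangular.
Variables (F : nzRingType) (n : nat).
Implicit Types a b c d e f : 'M[F]_n.

Definition utri a b c d e f : 'M[F]_(n + (n + n)) :=
  block_mx a (row_mx b c) 0 (block_mx d e 0 f).

Lemma utriM a b c d e f a' b' c' d' e' f' :
  utri a b c d e f * utri a' b' c' d' e' f' =
  utri (a * a') (a * b' + b * d') (a * c' + b * e' + c * f')
    (d * d') (d * e' + e * f') (f * f').
Proof.
rewrite /utri -!mulmxE !mulmx_block mul_mx_row mul_row_block.
by rewrite !mulmx0 !mul0mx !addr0 !add0r add_row_mx ?addrA.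
Qed.

Lemma utriN a b c d e f :
  - utri a b c d e f = utri (- a) (- b) (- c) (- d) (- e) (- f).
Proof. by rewrite /utri !opp_block_mx opp_row_mx !oppr0. Qed.

Lemma utriD a b c d e f a' b' c' d' e' f' :
  utri a b c d e f + utri a' b' c' d' e' f' =
  utri (a + a') (b + b') (c + c') (d + d') (e + e') (f + f').
Proof. by rewrite /utri !add_block_mx add_row_mx !addr0. Qed.

Lemma utri0 : utri 0 0 0 0 0 0 = 0.
Proof. by rewrite /utri row_mx0 !block_mx0. Qed.

Lemma utri1 : utri 1 0 0 1 0 1 = 1.
Proof. by rewrite /utri row_mx0 -!scalar_mx_block. Qed.

Lemma utri_corner_eq0 c : utri 0 0 c 0 0 0 = 0 -> c = 0.
Proof.
by move/eqP; rewrite block_mx_eq0 row_mx_eq0 => /and4P[_ /andP[_ /eqP]].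
Qed.
End UpperTriangular.
(* [sg] is the parity operator and [dl be] an odd element inducing on the block
   [be] the derivation [z i |-> th i]. They are what makes the induction on the
   number [n] of generators possible: with new elements [u], [t] such that
   [[u, t] = th n], one sets [z n = t + th n * dl (blk n)] and adds [u] to
   [dl (blk n)]. *)
Record superalg (R : pzRingType) (blk : nat -> bool) (n : nat)
    (z th : nat -> R) (sg : R) (dl : bool -> R) : Prop := Superalg {
  sa_zz : forall i j, comm (z i) (z j) = if blk i == blk j then th i * th j else 0;
  sa_zth : forall i j, GRing.comm (z i) (th j);
  sa_thN : forall i j, th i * th j = - (th j * th i);
  sa_th2 : forall i, th i * th i = 0;
  sa_th0 : forall i, (n <= i)%N -> th i = 0;
  sa_prod : \prod_(0 <= i < n) th i != 0;
  sa_sg2 : sg * sg = 1;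
  sa_sgz : forall i, GRing.comm sg (z i);
  sa_sgth : forall i, th i * sg = - (sg * th i);
  sa_sgdl : forall be, dl be * sg = - (sg * dl be);
  sa_dlz : forall be i, comm (dl be) (z i) = if blk i == be then th i else 0;
  sa_dlth : forall be i, th i * dl be = - (dl be * th i);
  sa_dldl : forall be ga, dl be * dl ga = - (dl ga * dl be);
  sa_dl2 : forall be, dl be * dl be = 0
}.

Section Step.
Variables (F : nzRingType) (N : nat) (blk : nat -> bool) (n : nat).
Variables (z th : nat -> 'M[F]_N) (sg : 'M[F]_N) (dl : bool -> 'M[F]_N).
Hypothesis sa : superalg blk n z th sg dl.

Let up (a : 'M[F]_N) := utri a 0 0 a 0 a.
(** With block matrix units, t = E_23 and u = [sg] E_12, so [u, t] = [sg] E_13 is the new [th n].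
    The factor [sg] makes u and [th n] anticommute with the old odd elements; the sign in [sg']
    makes them odd while t stays even. *)
Let z' i := if i == n then utri 0 0 (sg * dl (blk n)) 0 1 0 else up (z i).
Let th' i := if i == n then utri 0 0 sg 0 0 0 else up (th i).
Let sg' := utri (- sg) 0 0 sg 0 sg.
Let dl' be := utri (dl be) (if blk n == be then sg else 0) 0 (dl be) 0 (dl be).

Let usimp := (utriM, utriN, utriD, mulr0, mul0r, addr0, add0r, mulr1, mul1r,
  oppr0, subr0, sub0r).

Lemma superalg_step : superalg blk n.+1 z' th' sg' dl'.
Proof.
have [zz zth thN th2 th0 thp sg2 sgz sgth sgdl dlz dlth dldl dl2] := sa.
have sgdlz be i : sg * dl be * z i - z i * (sg * dl be) =
    if blk i == be then sg * th i else 0.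
  have := congr1 ( *%R sg) (dlz be i); rewrite /comm mulrBr !mulrA -sgz => ->.
  by case: eqP => // _; rewrite mulr0.
have zsgdl i be : z i * (sg * dl be) - sg * dl be * z i =
    if blk i == be then th i * sg else 0.
  by rewrite -opprB sgdlz sgth; case: eqP; rewrite ?oppr0.
split.
- move=> i j; rewrite /z' /th' /comm.
  have [->|ni] := eqVneq i n; have [->|nj] := eqVneq j n; rewrite !usimp.
  + by rewrite eqxx.
  + by rewrite sgdlz subrr eq_sym; case: ifP => _; rewrite ?utri0.
  + by rewrite zsgdl subrr; case: ifP => _; rewrite ?utri0.
  + by rewrite -!/(comm _ _) !zz; case: ifP => _; rewrite ?utri0.
- move=> i j; rewrite /z' /th' /GRing.comm.
  case: eqP => _; case: eqP => _; rewrite !usimp ?zth ?sgz //.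
  by rewrite mulrA sgth mulNr -[in RHS]mulrA dlth mulrN opprK mulrA.
- move=> i j; rewrite /th'.
  by case: eqP => _; case: eqP => _; rewrite !usimp // ?utri0 ?sgth ?opprK // -thN.
- move=> i; rewrite /th'.
  by case: eqP => _; rewrite !usimp // ?th2 utri0.
- move=> i ni; by rewrite /th' gtn_eqF // th0 1?ltnW // /up utri0.
- rewrite big_nat_recr //= /th' eqxx.
  have -> : \prod_(0 <= i < n) (if i == n then utri 0 0 sg 0 0 0 else up (th i))
     = up (\prod_(0 <= i < n) th i).
    have upM a b : up (a * b) = up a * up b by rewrite /up !usimp.
    have up1 : up 1 = 1 by apply: utri1.
    rewrite (big_morph up upM up1) !big_nat; apply: eq_bigr => i /andP[_ /ltn_eqF ->] //.
  (* The new product has corner entry the old product times [sg], and [sg] is invertible. *)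
  rewrite !usimp; apply: contraNneq thp => E.
  have := congr1 ( *%R^~ sg) (utri_corner_eq0 E).
  by rewrite /= -mulrA sg2 mulr1 mul0r => ->.
- by rewrite /sg' !usimp mulrNN sg2; apply: utri1.
- move=> i; rewrite /GRing.comm /z' /sg'; case: eqP => _; rewrite !usimp.
    by rewrite -mulrA sgdl mulrN mulNr mulrA.
  by rewrite mulNr mulrN !sgz.
- move=> i; rewrite /th' /sg'; case: eqP => _; rewrite !usimp ?mulNr ?opprK //.
  by rewrite mulrN !sgth opprK.
- move=> be; rewrite /dl' /sg' !usimp !mulrN mulNr !sgdl !opprK.
  by case: eqP => _; rewrite ?usimp ?mulNr ?opprK.
- move=> be i; rewrite /comm /dl' /z' /th'; have [->|_] := eqVneq i n; rewrite !usimp.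
    rewrite mulrA sgdl mulNr -[sg * _ * _]mulrA dldl mulrN opprK mulrA.
    rewrite addrAC addNr add0r subrr.
    by case: ifP => _; rewrite ?utri0.
  rewrite -!/(comm _ _) dlz.
  have -> : comm (if blk n == be then sg else 0) (z i) = 0.
    by case: ifP => _; rewrite /comm ?usimp // sgz subrr.
  by case: ifP => _; rewrite ?utri0.
- move=> be i; rewrite /dl' /th'; have [_|_] := eqVneq i n; rewrite !usimp.
    by rewrite sgdl opprK.
  by rewrite !dlth; case: ifP => _; rewrite ?sgth ?usimp.
- move=> be ga; rewrite /dl' !usimp !(dldl be); congr utri.
  by case: ifP => _; case: ifP => _; rewrite ?usimp // !sgdl ?opprD ?opprK // addrC.
- move=> be; rewrite /dl' !usimp dl2.
  by case: ifP => _; rewrite ?usimp ?sgdl ?addNr utri0.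
Qed.
End Step.

Lemma superalg_exists (F : nzRingType) (blk : nat -> bool) n :
  exists N (z th : nat -> 'M[F]_N) sg dl, (0 < N)%N /\ superalg blk n z th sg dl.
Proof.
elim: n => [|n [N [z [th [sg [dl [N0 sa]]]]]]].
  pose zero (T : Type) (_ : T) : 'M[F]_1 := 0.
  exists 1, (@zero nat), (@zero nat), 1, (@zero bool); split=> //.
  split=> *; rewrite /zero /comm /GRing.comm ?mulr0 ?mul0r ?subrr ?oppr0 ?if_same //.
    by rewrite big_geq // oner_neq0.
  by rewrite mulr1.
have sa' := superalg_step sa.
exists (N + (N + N))%N; do 4![eexists]; split; last exact: sa'.
by rewrite addn_gt0 N0.
Qed.

(** * Subalgebras and the ideals T^(n) *)

Record subalg (F : nzRingType) (L : algType F) := Subalg {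
  subalg_mem :> L -> Prop;
  subalg1 : subalg_mem 1;
  subalg_lin : forall c a b, subalg_mem a -> subalg_mem b -> subalg_mem (c *: a + b);
  subalgM : forall a b, subalg_mem a -> subalg_mem b -> subalg_mem (a * b)
}.

Section SubalgType.
Variables (F : nzRingType) (L : algType F) (S : subalg L).

(** Membership in a span is a proposition, while substructures need a boolean predicate; classical
    logic supplies it. *)
Definition subalg_pred : {pred L} := fun a => boolp.asbool (S a).

Lemma subalg_predP a : reflect (S a) (a \in subalg_pred).
Proof. exact: boolp.asboolP. Qed.

Lemma subalg_pred_closed : subalg_closed subalg_pred.
Proof.
split; first exact/subalg_predP/subalg1.
  by move=> c a b /subalg_predP Sa /subalg_predP Sb; apply/subalg_predP/subalg_lin.
by move=> a b /subalg_predP Sa /subalg_predP Sb; apply/subalg_predP/subalgM.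
Qed.

HB.instance Definition _ :=
  GRing.isSubalgClosed.Build F L subalg_pred subalg_pred_closed.

Record subalg_type := SubalgType {
  subalg_val : L;
  subalg_valP : subalg_val \in subalg_pred
}.

HB.instance Definition _ := [isSub for subalg_val].
HB.instance Definition _ := [Choice of subalg_type by <:].
HB.instance Definition _ := [SubChoice_isSubAlgebra of subalg_type by <:].

Lemma subalg_exists : exists (A : algType F) (f : {rmorphism A -> L}),
  [/\ injective f, forall a, S (f a) & forall x, S x -> exists a, f a = x].
Proof.
exists subalg_type, (\val : {rmorphism subalg_type -> L}); split.
- exact: val_inj.
- by move=> a; apply/subalg_predP/subalg_valP.
- by move=> x /subalg_predP Sx; exists (SubalgType Sx).
Qed.
End SubalgType.

Lemma map_lcomm (A L : pzRingType) (f : {rmorphism A -> L}) (s : seq A) :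
  f (lcomm s) = lcomm (map f s).
Proof.
case: s => [|a s]; first by rewrite /lcomm /= rmorph0.
rewrite /lcomm /=; elim: s a => //= b s IH a.
by rewrite IH /comm rmorphB !rmorphM.
Qed.

Lemma map_surj (A L : eqType) (f : A -> L) (s : seq L) :
  (forall x, x \in s -> exists a, f a = x) -> exists t, map f t = s.
Proof.
elim: s => [|x s IH] xs; first by exists [::].
have [a <-] := xs x (mem_head _ _).
have [|t <-] := IH; last by exists (a :: t).
by move=> y ys; apply: xs; rewrite inE ys orbT.
Qed.

(** As [c, a] = ca - ac lies in any ideal containing c, the ideals decrease; this reduces an odd m_i
    to m_i + 1. *)
Lemma Tn_succ (R : pzRingType) n (x : R) : Tn n.+1 x -> Tn n x.
Proof.
rewrite /Tn; case: n => [|[|n]] //= Tx J Ji JS; apply: Tx => // y [s [ss ->]].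
case/lastP: s ss => // s a; rewrite size_rcons => -[ss].
rewrite lcomm_rcons ?ss //; case: Ji => _ JB Jl Jr.
have Js : J (lcomm s) by apply: JS; exists s.
by apply: JB; [exact: Jr | exact: Jl].
Qed.

Lemma Tn_lcomm (R : pzRingType) (s : seq R) n : size s = n -> Tn n (lcomm s).
Proof. by rewrite /Tn; case: ifP => // _ ss J _ JS; apply: JS; exists s. Qed.

Lemma Tn_eq0 (R : pzRingType) n (x : R) : (1 < n)%N ->
  (forall s : seq R, size s = n -> lcomm s = 0) -> Tn n x -> x = 0.
Proof.
rewrite /Tn ltnNge => /negPf -> s0 Tx; apply: (Tx (eq^~ 0)); last first.
  by move=> y [s [/s0 <- ->]].
by split=> // [a b -> ->|a b ->|a b ->]; rewrite ?subrr ?mulr0 ?mul0r.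
Qed.

(** * Blocks of generators *)

(* The [i]-th block consists of [2 p_i + 1] pairs of generators, alternately taken
   from G and H and starting with G; [offset i] is the index of its first pair. *)
Section AlternatingBlocks.
Variable p : nat -> nat.

Definition offset i := (\sum_(0 <= j < i) (p j).*2.+1)%N.

Lemma offsetS i : offset i.+1 = (offset i + (p i).*2.+1)%N.
Proof. by rewrite /offset big_nat_recr. Qed.

Lemma big_offset (R : Type) (idx : R) (op : Monoid.law idx) (G : nat -> R) k :
  \big[op/idx]_(0 <= i < k) \big[op/idx]_(offset i <= q < offset i + (p i).*2.+1) G q
  = \big[op/idx]_(0 <= q < offset k) G q.
Proof.
elim: k => [|k IH]; first by rewrite /offset !big_geq.
by rewrite big_nat_recr //= IH offsetS [RHS](big_cat_nat (n := offset k)) //= leq_addr.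
Qed.

Fixpoint block_sign k q : bool :=
  if k is k'.+1 then
    if (q < offset k')%N then block_sign k' q else ~~ odd (q - offset k')
  else true.

Lemma block_signE k i r : (i < k)%N -> (r < (p i).*2.+1)%N ->
  block_sign k (offset i + r) = ~~ odd r.
Proof.
move=> + ri; elim: k => // k IH; rewrite ltnS leq_eqVlt => /orP[/eqP -> /=|ik /=].
  by rewrite ltnNge leq_addr addKn.
rewrite ifT ?IH //; apply: (@leq_trans (offset i.+1)).
  by rewrite offsetS ltn_add2l.
by rewrite /offset [leqRHS](big_cat_nat (n := i.+1)) //= leq_addr.
Qed.

Lemma count_odd_iota n : count odd (iota 0 n.*2.+1) = n.
Proof.
elim: n => // n IH; rewrite doubleS -addn2 iotaD count_cat IH add0n /=.
by rewrite odd_double /= addn0 addn1.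
Qed.

(** A block of 2 p_i + 1 alternating pairs starting in G has p_i pairs in H, so H has P pairs in
    all. *)
Lemma count_block_sign k :
  count (fun q => block_sign k q == false) (iota 0 (offset k))
  = (\sum_(0 <= i < k) p i)%N.
Proof.
elim: k => [|k IH]; first by rewrite /offset !big_geq.
rewrite big_nat_recr //= -IH offsetS iotaD count_cat add0n; congr (_ + _)%N.
  by apply: eq_in_count => q; rewrite mem_iota add0n => /andP[_ ->].
rewrite -[in RHS](count_odd_iota (p k)) -[X in iota X](addn0 (offset k)) iotaDl count_map.
by apply: eq_count => r /=; rewrite ltnNge leq_addr addKn eqbF_neg negbK.
Qed.
End AlternatingBlocks.

(** * Passing from pairs to generators, and the conclusion *)

Lemma count_half (P : pred nat) n :
  count (fun i => P i./2) (iota 0 n.*2) = (count P (iota 0 n)).*2.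
Proof.
elim: n => // n IH; rewrite doubleS -addn2 iotaD count_cat IH add0n.
rewrite -[in RHS]addn1 iotaD count_cat /= !doubleD doubleK uphalf_double !addn0 add0n.
by rewrite addnn.
Qed.

Lemma prod_double (R : pzSemiRingType) (G : nat -> R) n :
  \prod_(0 <= q < n) (G q.*2 * G q.*2.+1) = \prod_(0 <= i < n.*2) G i.
Proof.
elim: n => [|n IH]; first by rewrite !big_geq.
by rewrite doubleS !big_nat_recr //= IH mulrA.
Qed.

Lemma exists_nat_fun k (g : 'I_k -> nat) :
  exists p : nat -> nat, forall i : 'I_k, p i = g i.
Proof.
exists (fun j => if insub j is Some i then g i else 0)%N => i.
by rewrite (valK i).
Qed.

Theorem theorem1p7 (F : fieldType) (k l : nat) (m : 'I_k -> nat) :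
  (0 < k)%N -> (l <= k)%N -> (forall i, (0 < m i)%N) ->
  #|[set i | odd (m i)]| = l ->
  let N := ((\sum_(i < k) m i) + l + 2 - 2 * k)%N in
  exists A : algType F,
    ~ @ideal_sub A (@ideal_prod A k (fun i : 'I_k => @Tn A (m i))) (@Tn A (1 + N)).
Proof.
move=> _ _ m0 ml N; have [p pE] := exists_nat_fun (fun i => (m i).-1./2).
have mE i : (m i + odd (m i) = (p i).*2.+2)%N.
  rewrite pE; have := m0 i; case: (m i) => // j _ /=.
  by rewrite -{1}(odd_double_half j); case: (odd j); rewrite /= ?addn0 ?addn1.
pose P := (\sum_(0 <= i < k) p i)%N.
(* Since l is the sum of the parities, the sum of the m_i plus l is 2P + 2k, so the truncated
   subtraction is exact. *)
have NE : N = P.*2.+2.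
  rewrite /N; have -> : l = (\sum_(i < k) odd (m i))%N.
    rewrite -ml -sum1_card big_mkcond; apply: eq_bigr => i _.
    by rewrite inE; case: odd.
  rewrite -big_split /= (eq_bigr (fun i : 'I_k => (p i).*2 + 2)%N); last first.
    by move=> i _; rewrite addn2 -mE.
  rewrite big_split /= sum_nat_const card_ord mulnC addnAC addnK.
  by rewrite addn2 /P big_mkord (big_morph double doubleD (erefl _)).
rewrite {}NE; pose n := offset p k; pose blk i := block_sign p k i./2.
(* There are [n] pairs, hence [n.*2] generators; positive matrix size makes [L] a nonzero ring. *)
have [[|d] [z [th [sg [dl [// _ sa]]]]]] := superalg_exists F blk n.*2.
pose L : algType F := 'M[F]_d.+1.
have [zz zth thN th2 th0 thp _ _ _ _ _ _ _ _] := sa.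
have th_eq0 t : all (fun i => blk i == false) t -> (P.*2 < size t)%N -> thprod th t = 0.
  apply: (thprod_eq0 thN th2 th0); rewrite /blk.
  by rewrite (count_half (fun q => block_sign p k q == false)) count_block_sign.
pose T : L -> Prop := @tensor F L z th blk.
pose S := @Subalg F L T (@tensor1 F L z th blk)
  (@span_lin F L _) (@tensorM F L z th blk zz zth).
have [A [f [injf fT surjf]]] := subalg_exists S.
exists A => sub.
have a_exists (i : 'I_k) : exists a : A, Tn (m i) a /\
    f a = \prod_(offset p i <= q < offset p i + (p i).*2.+1) pair_comm z q.
  have sgnE q : (q < (p i).*2.+1)%N -> blk (offset p i + q).*2 = ~~ odd q /\
      blk (offset p i + q).*2.+1 = ~~ odd q.
    by move=> qp; rewrite /blk /= uphalf_double doubleK block_signE.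
  have [s [ss sT sE]] :=
    @lcomm_alternating F L z th blk zz zth thN _ _ 1 sgnE (fil1 _ _ _ _).
  have [t ft] := @map_surj A L f s (fun x xs => surjf x (sT x xs)).
  exists (lcomm t); split; last by rewrite map_lcomm ft sE mulr1.
  have : Tn (p i).*2.+2 (lcomm t) by apply: Tn_lcomm; rewrite -ss -ft size_map.
  by rewrite -mE; case: odd; rewrite ?addn1 ?addn0 // => /Tn_succ.
have [a aE] := fin_all_exists a_exists.
have /sub/Tn_eq0 a0 : ideal_prod (fun i => @Tn A (m i)) (\prod_(i < k) a i).
  by move=> J _; apply; exists a; split=> // i; case: (aE i).
(* The assumed inclusion puts the product in T^(2P + 3)(A), which is zero because [f] is injective
   and the commutators vanish in [L]. *)
have {}a0 : \prod_(i < k) a i = 0.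
  apply: a0 => // s ss; apply: injf; rewrite rmorph0 map_lcomm.
  apply: (@lcomm_tensor_eq0 F L z th blk zz zth thN P _ th_eq0).
    by rewrite size_map ss.
  by move=> _ /mapP[b _ ->]; apply: fT.
(* Each [pair_comm z q] is [th q.*2 * th q.*2.+1], so the consecutive blocks multiply to the nonzero
   product of all [th i]. *)
case/eqP: thp; rewrite -prod_double.
transitivity (f (\prod_(i < k) a i)); last by rewrite a0 rmorph0.
rewrite rmorph_prod (eq_bigr _ (fun i _ => proj2 (aE i))).
rewrite -(big_mkord xpredT
  (fun i => \prod_(offset p i <= q < offset p i + (p i).*2.+1) pair_comm z q)).
rewrite big_offset; apply: eq_bigr => q _; rewrite /pair_comm zz.
by rewrite /blk /= uphalf_double doubleK eqxx.
Qed.
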